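(* For any constant $k\ge 1$, there is an online algorithm with competitive ratio at most $\frac{1000k(k+1)}{9}$ for the submodular matroid secretary problem in which the feasible sets are the intersection of $k$ laminar matroids. That is, for every family of $k$ laminar matroids $(U,\mathcal{I}_1),\dots,(U,\mathcal{I}_k)$ on a common ground set and every non-negative, monotonically non-decreasing submodular $f$, the accepted set $\mathrm{ALG}$ always lies in $\mathcal{I}_1\cap\dots\cap\mathcal{I}_k$ and $\mathbb{E}[f(\mathrm{ALG})]\ge \frac{9}{1000k(k+1)}\max_{T\in\mathcal{I}_1\cap\cdots\cap\mathcal{I}_k}f(T)$.
   Context: Online setting: $U$ is a finite ground set; the independence system $\mathcal{I}=\mathcal{I}_1\cap\dots\cap\mathcal{I}_k$ is known to the algorithm. An adversary fixes a non-negative, monotonically non-decreasing submodular $f:2^U\to\mathbb{R}_{\ge0}$ ($f(S)+f(T)\ge f(S\cup T)+f(S\cap T)$). Elements arrive one by one in uniformly random order; the algorithm can query $f$ only on sets of already-arrived elements; upon arrival of an element it must irrevocably accept or reject it; the accepted set must always be in $\mathcal{I}$. Competitive ratio at most $C$ means $\mathbb{E}[f(\mathrm{ALG})]\ge \frac1C\max_{T\in\mathcal{I}}f(T)$ for every $f$, expectation over the random order and the algorithm's randomness. Laminar matroid: given a laminar family $\mathcal{F}$ of subsets of $U$ (any two members are disjoint or nested) with integer capacities $\mu(B)$, $B\in\mathcal{F}$, the independent sets are the $T\subseteq U$ with $|T\cap B|\le\mu(B)$ for all $B\in\mathcal{F}$. *)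

(* Defs.v *)
From HB Require Import structures.
From mathcomp Require Import all_boot all_order all_algebra fingroup perm.
From mathcomp Require Import reals.
Set Implicit Arguments. Unset Strict Implicit. Unset Printing Implicit Defensive.
Import Order.TTheory GRing.Theory Num.Theory.
Local Open Scope ring_scope.

Section Defs.
Variable U : finType.

Definition laminar (F : {set {set U}}) : Prop :=
  forall A B, A \in F -> B \in F ->
    [|| A \subset B, B \subset A | [disjoint A & B]].

Definition lam_indep (F : {set {set U}}) (mu : {set U} -> nat) (T : {set U}) : Prop :=
  forall B, B \in F -> (#|T :&: B| <= mu B)%N.

Definition indep_k (k : nat) (F : 'I_k -> {set {set U}})
  (mu : 'I_k -> {set U} -> nat) (T : {set U}) : Prop :=
  forall i, lam_indep (F i) (mu i) T.

Variable R : realType.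

Definition valid_fun (f : {set U} -> R) : Prop :=
  [/\ forall S : {set U}, 0 <= f S,
      forall S T : {set U}, S \subset T -> f S <= f T
    & forall S T : {set U}, f (S :|: T) + f (S :&: T) <= f S + f T].

(* A (randomized) online algorithm with finitely many random outcomes
   omega : 'I_m drawn with probabilities p.  For outcome omega, the decision
   on the current element is [dec omega s f], where s is the sequence of the
   elements arrived so far (the current one last) and f the objective.
   The decision may only depend on the values of f on subsets of arrived
   elements (locality condition below). *)
Definition prob_dist (m : nat) (p : 'I_m -> R) : Prop :=
  (forall w, 0 <= p w) /\ \sum_(w < m) p w = 1.

Definition online_local (m : nat) (dec : 'I_m -> seq U -> ({set U} -> R) -> bool)
  : Prop :=
  forall w s (f f' : {set U} -> R),
    (forall S : {set U}, S \subset [set x in s] -> f S = f' S) ->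
    dec w s f = dec w s f'.

Definition arrival (sigma : {perm U}) : seq U := [seq sigma x | x <- enum U].

Definition alg_set (m : nat) (dec : 'I_m -> seq U -> ({set U} -> R) -> bool)
  (w : 'I_m) (sigma : {perm U}) (f : {set U} -> R) : {set U} :=
  let s := arrival sigma in
  [set x | dec w (take (index x s).+1 s) f].

Definition expected_value (m : nat) (p : 'I_m -> R)
  (dec : 'I_m -> seq U -> ({set U} -> R) -> bool) (f : {set U} -> R) : R :=
  (#|{perm U}|%:R)^-1 *
    \sum_(sigma : {perm U}) \sum_(w < m) p w * f (alg_set dec w sigma f).

End Defs.

(* Main.v *)
Require Import Defs.
From HB Require Import structures.
From mathcomp Require Import all_boot all_order all_algebra fingroup perm.
From mathcomp Require Import reals ring lra zify.
Import Order.TTheory GRing.Theory Num.Theory.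
Local Open Scope ring_scope.

(** Reject a random sample [H] containing each element with probability
    [p = 1 - q], [q = 1 / (40 k)].  Call a later element a candidate if the greedy
    algorithm on [H] plus that element would select it, and accept a candidate if
    no constraint containing it has already met more candidates than its capacity.

    Revealing membership in [H] only when greedy examines an element turns the
    analysis into a coin process: the best feasible unseen element [e] with respect
    to the head set [M] joins [M] with probability [p] and the candidate set [N]
    otherwise.  Let [a] and [b] be the marginal values of [e] over [M] and over
    [M :|: N].  A martingale argument gives
    [E (sum of b over N) >= p q E (sum of a)].  On the other hand, [a] decreases
    along the process and a constraint of capacity [m] receives at most [m] heads,
    so an exponential supermartingale bounds the value lost to its overflow by
    [(20 k)^-1 (5 k)^-m] times the total [a] inside it; keeping only the maximal
    constraints of each capacity, these factors sum to at most [1 / (80 k)] over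
    all constraints containing a given element.  Finally the total [a] is at least
    [f M - f set0], and greedy is a [k + 1]-approximation on [H]. *)

Set Implicit Arguments. Unset Strict Implicit. Unset Printing Implicit Defensive.

(** * Independent coins *)

Section Coins.
Variables (R : realFieldType) (U : finType) (p : R).
Implicit Types (H : {set U}) (G : {set U} -> R).

Definition wt H : R := \prod_x (if x \in H then p else 1 - p).
Definition Ex G : R := \sum_H wt H * G H.

Lemma wt_ge0 H : 0 <= p <= 1 -> 0 <= wt H.
Proof.
move=> /andP[p0 p1]; apply: prodr_ge0 => x _; case: ifP => // _.
by rewrite subr_ge0.
Qed.

Lemma sum_wt : \sum_H wt H = 1.
Proof.
rewrite /wt -(bigA_distr 1 +%R (fun _ : U => p) (fun _ : U => 1 - p)).
by rewrite big1 //= => i _; rewrite subrKC.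
Qed.

Lemma wt_imset (s : {perm U}) H : wt (s @: H) = wt H.
Proof.
rewrite /wt (reindex_inj (@perm_inj _ s)) /=; apply: eq_bigr => x _.
by rewrite (mem_imset _ _ (@perm_inj _ s)).
Qed.

(** All coins have the same bias, so relabelling the ground set changes nothing; this later absorbs
    the random arrival order. *)
Lemma Ex_imset (s : {perm U}) G : Ex (fun H => G (s @: H)) = Ex G.
Proof.
rewrite /Ex [RHS](reindex_inj (imset_inj (@perm_inj _ s))) /=.
by apply: eq_bigr => H _; rewrite wt_imset.
Qed.

Lemma ExD G1 G2 : Ex (fun H => G1 H + G2 H) = Ex G1 + Ex G2.
Proof. by rewrite /Ex -big_split /=; apply: eq_bigr => H _; rewrite mulrDr. Qed.

Lemma ExZ c G : Ex (fun H => c * G H) = c * Ex G.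
Proof. by rewrite /Ex mulr_sumr; apply: eq_bigr => H _; rewrite mulrCA. Qed.

Lemma Ex_cst c : Ex (fun=> c) = c.
Proof. by rewrite /Ex -mulr_suml sum_wt mul1r. Qed.

Lemma ExB G1 G2 : Ex (fun H => G1 H - G2 H) = Ex G1 - Ex G2.
Proof.
rewrite -[Ex G2]mul1r -mulNr -ExZ -ExD.
by apply: eq_bigr => H _; rewrite mulN1r.
Qed.

Lemma Ex_sum (I : finType) (P : pred I) (G : I -> {set U} -> R) :
  Ex (fun H => \sum_(i | P i) G i H) = \sum_(i | P i) Ex (G i).
Proof.
rewrite /Ex exchange_big /=; apply: eq_bigr => H _.
by rewrite mulr_sumr.
Qed.

Lemma eq_Ex G1 G2 : G1 =1 G2 -> Ex G1 = Ex G2.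
Proof. by move=> e; apply: eq_bigr => H _; rewrite e. Qed.

Lemma le_Ex G1 G2 : 0 <= p <= 1 -> (forall H, G1 H <= G2 H) -> Ex G1 <= Ex G2.
Proof.
by move=> hp le12; apply: ler_sum => H _; rewrite ler_wpM2l ?wt_ge0.
Qed.

(** Independence: the hypothesis says that [G] does not look at the coin of [e]. *)
Lemma Ex_coin (e : U) G :
  (forall H, G (e |: H) = G (H :\ e)) ->
  Ex (fun H => (e \in H)%:R * G H) = p * Ex G.
Proof.
move=> Ge.
pose c H := \prod_(x | x != e) (if x \in H then p else 1 - p).
have cU H : c (e |: H) = c H.
  by apply: eq_bigr => x ne; rewrite !inE (negPf ne).
have wtE H : wt H = (if e \in H then p else 1 - p) * c H.
  by rewrite /wt (bigD1 e).
have rem_e H : e \notin H -> H :\ e = H.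
  by move=> eH; rewrite setDE; apply/setIidPl; rewrite subsetC sub1set inE.
have split_e K : \sum_H K H = \sum_(H : {set U} | e \notin H) K (e |: H)
    + \sum_(H : {set U} | e \notin H) K H :> R.
  rewrite (bigID (fun H : {set U} => e \in H)) /=; congr (_ + _).
  rewrite (reindex_onto (fun H => e |: H) (fun H => H :\ e)) /=; last first.
    by move=> H eH; rewrite setD1K.
  apply: eq_bigl => H; rewrite setU11 /=; apply/eqP/idP => [<-|eH].
    by rewrite setD11.
  by rewrite setU1K.
pose S := \sum_(H : {set U} | e \notin H) c H * G H.
have -> : Ex G = S.
  rewrite /Ex split_e (_ : S = p * S + (1 - p) * S); last by ring.
  rewrite !mulr_sumr; congr (_ + _); apply: eq_bigr => H eH; rewrite wtE.
    by rewrite setU11 cU mulrA Ge rem_e.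
  by rewrite (negPf eH) mulrA.
rewrite /Ex split_e [X in _ + X]big1 ?addr0; last first.
  by move=> H /negPf ->; rewrite mul0r mulr0.
rewrite mulr_sumr; apply: eq_bigr => H eH.
by rewrite wtE setU11 cU mul1r mulrA Ge rem_e.
Qed.

Lemma Ex_if (e : U) G1 G2 :
  (forall H, G1 (e |: H) = G1 (H :\ e)) ->
  (forall H, G2 (e |: H) = G2 (H :\ e)) ->
  Ex (fun H => if e \in H then G1 H else G2 H) = p * Ex G1 + (1 - p) * Ex G2.
Proof.
move=> e1 e2; rewrite mulrBl mul1r -(Ex_coin e1) -(Ex_coin e2) -ExB -ExD.
apply: eq_Ex => H.
by case: (e \in H); rewrite ?mul1r ?mul0r ?subrr ?addr0 ?subr0 ?add0r.
Qed.

End Coins.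

(** * Marginal values of monotone submodular functions *)

Section Submodular.
Variables (R : realFieldType) (U : finType) (f : {set U} -> R).

Definition marg (S : {set U}) x := f (x |: S) - f S.

Hypothesis fmono : forall S T : {set U}, S \subset T -> f S <= f T.
Hypothesis fsub : forall S T : {set U}, f (S :|: T) + f (S :&: T) <= f S + f T.

Lemma marg_ge0 S x : 0 <= marg S x.
Proof. by rewrite subr_ge0 fmono // subsetUr. Qed.

Lemma marg_anti (S T : {set U}) x : S \subset T -> marg T x <= marg S x.
Proof.
move=> sST; have := fsub (x |: S) T.
rewrite -setUA (setUidPr sST).
(* The intersection is [S], or [x |: S] if [x] is already in [T]; containing [S] suffices in both
   cases. *)
have : f S <= f ((x |: S) :&: T) by apply: fmono; rewrite subsetI subsetUr.
by rewrite /marg; lra.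
Qed.

Lemma le_sum_marg (S T : {set U}) :
  f T <= f S + \sum_(x in T :\: S) marg S x.
Proof.
suff le_seq (s : seq U) :
    f (S :|: [set x in s]) <= f S + \sum_(x <- s) marg S x.
  apply: le_trans (fmono _) _; last first.
    by rewrite -big_enum /=; apply: (le_seq (enum (T :\: S))).
  by apply/subsetP => x xT; rewrite !inE mem_enum !inE xT andbT orbN.
elim: s => [|x s IH]; first by rewrite set_nil setU0 big_nil addr0.
rewrite set_cons setUCA big_cons.
have := @marg_anti S (S :|: [set y in s]) x (subsetUl _ _).
by move: IH; rewrite {2}/marg; lra.
Qed.

(** Elements of [T] are added one at a time: each is sampled with probability [p], and then its
    marginal value over the sampled earlier ones is at least that over all earlier ones. *)
Lemma Ex_setI_ge p (T : {set U}) : 0 <= p <= 1 ->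
  p * f T + (1 - p) * f set0 <= Ex p (fun H => f (T :&: H)).
Proof.
move=> hp; rewrite -[T]set_enum; elim: (enum T) => [|x s IH].
  rewrite set_nil (eq_Ex p (fun H => congr1 f (set0I H))) Ex_cst.
  by rewrite -mulrDl subrKC mul1r.
rewrite set_cons; set S := [set y in s] in IH *.
apply: (@le_trans _ _ (Ex p (fun H => (x \in H)%:R * marg S x + f (S :&: H)))).
  rewrite ExD (@Ex_coin _ _ _ x (fun=> marg S x)) // Ex_cst.
  by move: IH; rewrite /marg; lra.
apply: le_Ex => // H; rewrite setIUl; case: (boolP (x \in H)) => xH; last first.
  by rewrite mul0r add0r fmono // subsetUr.
have ->: [set x] :&: H = [set x] by apply/setIidPl; rewrite sub1set.
rewrite mul1r.
have := @marg_anti (S :&: H) S x (subsetIl _ _); rewrite /marg; lra.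
Qed.

End Submodular.

(** * The greedy process with coins *)

Section Histories.
Variable U : finType.
Implicit Types h : seq (U * bool).

(* A history lists the examined elements with their coins, the latest first. *)
Definition heads h : {set U} := [set x | (x, true) \in h].
Definition tails h : {set U} := [set x | (x, false) \in h].
Definition seen h : {set U} := heads h :|: tails h.

Lemma heads_cons e c h :
  heads ((e, c) :: h) = if c then e |: heads h else heads h.
Proof.
apply/setP => x; rewrite inE in_cons xpair_eqE.
by case: c; rewrite ?inE ?andbT ?andbF //= inE.
Qed.

Lemma tails_cons e c h :
  tails ((e, c) :: h) = if c then tails h else e |: tails h.
Proof.
apply/setP => x; rewrite inE in_cons xpair_eqE.
by case: c; rewrite ?inE ?andbT ?andbF //= inE.
Qed.

Lemma seen_cons e c h : seen ((e, c) :: h) = e |: seen h.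
Proof.
rewrite /seen heads_cons tails_cons; case: c; first by rewrite setUA.
by rewrite setUCA.
Qed.

Lemma heads_nil : heads [::] = set0. Proof. by apply/setP => x; rewrite !inE. Qed.
Lemma tails_nil : tails [::] = set0. Proof. by apply/setP => x; rewrite !inE. Qed.
Lemma seen_nil : seen [::] = set0.
Proof. by rewrite /seen heads_nil tails_nil setU0. Qed.

End Histories.

Section Greedy.
Variables (R : realFieldType) (U : finType) (I : pred {set U}).
Implicit Types (h : seq (U * bool)) (H V : {set U}) (f : {set U} -> R).

Definition avail V h : {set U} :=
  [set x in V | (x \notin seen h) && I (x |: heads h)].

(* The rank makes the greedy choice unique, so that it does not depend on the
   ground set [V] as long as it belongs to [V]. *)
Definition gkey f h x : (R *l 'I_#|U|)%type := (f (x |: heads h), enum_rank x).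

Definition gnext f V h : option U :=
  if [pick x in avail V h] is Some x0
  then Some [arg max_(x > x0 in avail V h) gkey f h x]%O else None.

(** [n] is fuel. Membership in [H] is consulted only for the element just examined, so every coin is
    revealed at most once. *)
Fixpoint run f V n H h :=
  if n is n'.+1 then
    if gnext f V h is Some e then run f V n' H ((e, e \in H) :: h) else h
  else h.

Lemma next_SomeP f V h e :
  gnext f V h = Some e <->
  e \in avail V h /\ forall x, x \in avail V h -> (gkey f h x <= gkey f h e)%O.
Proof.
rewrite /gnext; case: pickP => [x0 x0A|A0]; last first.
  by split=> // -[]; rewrite A0.
case: arg_maxP => // y yA ymax; split=> [[<-]|[eA emax]]; first by split.
congr Some; apply: enum_rank_inj.
have : gkey f h e = gkey f h y.
  by apply/eqP; rewrite eq_le emax // andbT; apply: (ymax e eA).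
by case.
Qed.

Lemma next_NoneP f V h : gnext f V h = None <-> avail V h = set0.
Proof.
rewrite /gnext; case: pickP => [x0 x0A|A0]; split=> //.
  by move=> A0; move: x0A; rewrite A0 inE.
by move=> _; apply/setP => x; rewrite A0 inE.
Qed.

Lemma next_avail f V h e : gnext f V h = Some e ->
  [/\ e \in V, e \notin seen h & I (e |: heads h)].
Proof. by move=> /next_SomeP[]; rewrite inE => /and3P[]. Qed.

Lemma next_max f V h e x : gnext f V h = Some e -> x \in avail V h ->
  marg f (heads h) x <= marg f (heads h) e.
Proof.
move=> /next_SomeP[_ emax] /emax; rewrite lexi_pair => /andP[le_xe _].
by rewrite lerD2r.
Qed.

Fixpoint greedy_hist f V h : Prop :=
  if h is (e, _) :: h' then gnext f V h' = Some e /\ greedy_hist f V h' else True.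

Lemma greedy_run f V n H h : greedy_hist f V h -> greedy_hist f V (run f V n H h).
Proof.
elim: n h => //= n IH h gh; case E: (gnext f V h) => [e|] //.
by apply: IH; split.
Qed.

Lemma run_stop f V n H h :
  (#|V :\: seen h| <= n)%N -> gnext f V (run f V n H h) = None.
Proof.
elim: n h => [|n IH] h /=.
  rewrite leqn0 cards_eq0 setD_eq0 => sV; apply/next_NoneP/setP => x.
  rewrite in_set0 in_set; apply/negP => /and3P[xV + _].
  by rewrite (subsetP sV x xV).
move=> cV; case E: (gnext f V h) => [e|] //=; apply: IH.
have [eV es _] := next_avail E.
rewrite seen_cons setUC -setDDl -ltnS; apply: leq_trans _ cV.
by rewrite [in X in (_ <= X)%N](cardsD1 e) inE es eV.
Qed.

Lemma run_tails f V n H h :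
  [disjoint tails h & H] -> [disjoint tails (run f V n H h) & H].
Proof.
elim: n h => //= n IH h hh; case: (gnext f V h) => [e|] //.
apply: IH; rewrite tails_cons; case: ifP => // eH.
rewrite -setI_eq0 setIUl setU_eq0 !setI_eq0 hh andbT.
by rewrite disjoints1 eH.
Qed.

(** A seen element is never available again, so its coin no longer matters. This is the independence
    that lets coins be revealed lazily. *)
Lemma run_coin f V n H h e :
  e \in seen h -> run f V n (e |: H) h = run f V n (H :\ e) h.
Proof.
elim: n h => //= n IH h eh; case E: (gnext f V h) => [x|] //.
have [_ xs _] := next_avail E.
have ne : x == e = false by apply/negP => /eqP xe; rewrite xe eh in xs.
rewrite !inE ne /= IH // seen_cons inE eh orbT //.
Qed.

(** With its heads inside [V], greedy on [V] evaluates [f] only on subsets of [V]; locality of the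
    online decisions rests on this. *)
Lemma eq_next f f' V h : (forall S : {set U}, S \subset V -> f S = f' S) ->
  heads h \subset V -> gnext f V h = gnext f' V h.
Proof.
move=> eqf hV.
have eqk x : x \in avail V h -> gkey f h x = gkey f' h x.
  rewrite inE => /andP[xV _]; rewrite /gkey eqf //.
  by rewrite subUset sub1set xV.
case E: (gnext f V h) => [e|]; apply/esym.
  apply/next_SomeP; have /next_SomeP[eA emax] := E; split=> // x xA.
  by rewrite -!eqk // emax.
by apply/next_NoneP; move/next_NoneP: E.
Qed.

Lemma eq_run f f' V n H h : (forall S : {set U}, S \subset V -> f S = f' S) ->
  heads h \subset V -> run f V n H h = run f' V n H h.
Proof.
move=> eqf; elim: n h => //= n IH h hV; rewrite -(eq_next eqf hV).
case E: (gnext f V h) => [e|] //; have [eV _ _] := next_avail E.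
by apply: IH; rewrite heads_cons; case: ifP => //; rewrite subUset sub1set eV hV.
Qed.

(* Elements outside [V] lie outside the sample [H], so they only join the
   tails, which never influence the head set. *)
Lemma run_restrict f V H n n' h h' :
  H \subset V -> heads h \subset V -> heads h' = heads h ->
  tails h' = tails h :&: V ->
  (#|~: seen h| <= n)%N -> (#|V :\: seen h'| <= n')%N ->
  tails (run f V n' H h') = tails (run f setT n H h) :&: V.
Proof.
move=> HV; elim: n n' h h' => [|n IH] n' h h' hV eH eT cn cn' /=.
  move: cn; rewrite leqn0 cards_eq0 -setTD setD_eq0 subTset => /eqP hT.
  have : V :\: seen h' = set0.
    have -> : seen h' = seen h :&: V.
      by rewrite /seen eH eT setIUl (setIidPl hV).
    by rewrite hT setTI setDv.
  move/eqP; rewrite setD_eq0 => sV.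
  case: n' cn' => [|n'] _ //=; case E: (gnext f V h') => [e|] //.
  have [eV es _] := next_avail E.
  by rewrite (subsetP sV e eV) in es.
have seenE x : x \in V -> (x \in seen h') = (x \in seen h).
  by move=> xV; rewrite /seen !in_setU eH eT in_setI xV andbT.
have availE : avail V h' = avail setT h :&: V.
  apply/setP => x; rewrite in_setI ![x \in avail _ _]in_set in_setT.
  by case: (boolP (x \in V)) => xV; rewrite ?andbF // seenE // eH andbT.
case E: (gnext f setT h) => [e|]; last first.
  case: n' cn' => [|n'] _ //=.
  have /next_NoneP A0 := E.
  by have /next_NoneP -> : avail V h' = set0 by rewrite availE A0 set0I.
have [_ es eI] := next_avail E; have /next_SomeP[eA emax] := E.
have cn1 : (#|~: seen ((e, e \in H) :: h)| <= n)%N.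
  rewrite seen_cons setCU -ltnS; apply: leq_trans _ cn.
  by rewrite [in X in (_ <= X)%N](cardsD1 e) inE es setIC setDE.
case: (boolP (e \in V)) => eV.
  have E' : gnext f V h' = Some e.
    apply/next_SomeP; rewrite availE inE eA eV; split=> // x.
    by rewrite inE => /andP[/emax + _]; rewrite /gkey eH.
  have es' : e \notin seen h' by rewrite seenE.
  case: n' cn' => [|n'] cn' /=.
    move: cn'; rewrite leqn0 cards_eq0 setD_eq0 => /subsetP/(_ e eV).
    by rewrite (negPf es').
  rewrite E'; apply: IH => //.
  - by rewrite heads_cons; case: ifP => //; rewrite subUset sub1set eV.
  - by rewrite !heads_cons eH.
  - rewrite !tails_cons; case: ifP => // _.
    by rewrite eT setIUl; congr (_ :|: _); apply/esym/setIidPl; rewrite sub1set.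
  - rewrite seen_cons setUC -setDDl -ltnS; apply: leq_trans _ cn'.
    by rewrite [in X in (_ <= X)%N](cardsD1 e) inE es' eV.
have eNH : e \in H = false by apply/negP => /(subsetP HV); rewrite (negPf eV).
rewrite -(IH n' ((e, e \in H) :: h) h') //.
- by rewrite heads_cons eNH.
- by rewrite heads_cons eNH.
- rewrite tails_cons eNH setIUl eT (_ : [set e] :&: V = set0) ?set0U //.
  by apply/eqP; rewrite setI_eq0 disjoints1.
Qed.

Fixpoint ev (p : R) f V n (Phi : seq (U * bool) -> R) h : R :=
  if n is n'.+1 then
    if gnext f V h is Some e then
      p * ev p f V n' Phi ((e, true) :: h)
      + (1 - p) * ev p f V n' Phi ((e, false) :: h)
    else Phi h
  else Phi h.

Lemma Ex_run (p : R) f V n (Phi : seq (U * bool) -> R) h :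
  Ex p (fun H => Phi (run f V n H h)) = ev p f V n Phi h.
Proof.
elim: n h => [|n IH] h /=; first exact: Ex_cst.
case E: (gnext f V h) => [e|]; last exact: Ex_cst.
rewrite -!IH -(@Ex_if _ _ _ e); first last.
- by move=> H; rewrite run_coin // seen_cons setU11.
- by move=> H; rewrite run_coin // seen_cons setU11.
by apply: eq_Ex => H; case: (e \in H).
Qed.

(** Optional stopping for a submartingale; the drift inequality is needed only at histories that
    follow the greedy choices. *)
Lemma Ex_run_ge (p : R) f V n (Phi : seq (U * bool) -> R) : 0 <= p <= 1 ->
  (forall h e, greedy_hist f V h -> gnext f V h = Some e ->
    Phi h <= p * Phi ((e, true) :: h) + (1 - p) * Phi ((e, false) :: h)) ->
  Phi [::] <= Ex p (fun H => Phi (run f V n H [::])).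
Proof.
move=> /andP[p0 p1] drift; rewrite Ex_run.
have : greedy_hist f V [::] by [].
elim: n [::] => //= n IH h gh; case E: (gnext f V h) => [e|] //.
apply: le_trans (drift h e gh E) _; apply: lerD.
  by rewrite ler_wpM2l //; apply: IH.
by rewrite ler_wpM2l ?subr_ge0 //; apply: IH.
Qed.

End Greedy.

(** * Gains along a greedy history *)

Section Gains.
Variables (R : realFieldType) (U : finType) (I : pred {set U}).
Variable f : {set U} -> R.
Implicit Types (h : seq (U * bool)) (B X S T : {set U}).

Fixpoint hsum (g : seq (U * bool) -> U -> bool -> R) h : R :=
  if h is (e, c) :: h' then g h' e c + hsum g h' else 0.

Definition gain (P : U -> bool -> bool) h : R :=
  hsum (fun h e c => (P e c)%:R * marg f (heads h) e) h.

(** Marginals are over everything seen, not only over the tails in [X]: the resulting lower bound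
    stays valid for whichever subset of the tails survives. *)
Definition tail_gain X h : R :=
  hsum (fun h e c => (~~ c && (e \in X))%:R * marg f (seen h) e) h.

Lemma gain_cons P e c h :
  gain P ((e, c) :: h) = (P e c)%:R * marg f (heads h) e + gain P h.
Proof. by []. Qed.

Lemma tail_gain_cons X e c h : tail_gain X ((e, c) :: h)
  = (~~ c && (e \in X))%:R * marg f (seen h) e + tail_gain X h.
Proof. by []. Qed.

Fixpoint first_gain B h : R :=
  if h is (e, _) :: h' then
    if (e \in B) && (seen h' :&: B == set0) then marg f (heads h') e
    else first_gain B h'
  else 0.

Definition stuck T h : {set U} := [set o in T :\: seen h | ~~ I (o |: heads h)].

Hypothesis I0 : I set0.
Hypothesis Isub : forall S T : {set U}, S \subset T -> I T -> I S.
Hypothesis fmono : forall S T : {set U}, S \subset T -> f S <= f T.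
Hypothesis fsub : forall S T : {set U}, f (S :|: T) + f (S :&: T) <= f S + f T.

Local Notation gnext := (gnext I f setT).
Local Notation greedy := (greedy_hist I f setT).
Local Notation avail := (avail I setT).

Lemma greedy_indep h : greedy h -> I (heads h).
Proof.
elim: h => [|[e c] h IH] /=; first by rewrite heads_nil.
move=> [E /IH Ih]; rewrite heads_cons; case: c => //.
by have [] := next_avail E.
Qed.

Lemma avail_cons e c h x :
  x \in avail ((e, c) :: h) -> x \in avail h.
Proof.
rewrite ![x \in avail _]in_set seen_cons in_setU1 negb_or heads_cons.
move=> /and3P[_ /andP[_ ->]]; rewrite in_setT /=; case: c => //.
by apply: Isub; apply: setUS; apply: subsetUr.
Qed.

Lemma marg_cons e c h x :
  marg f (heads ((e, c) :: h)) x <= marg f (heads h) x.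
Proof. by apply: marg_anti => //; rewrite heads_cons; case: c => //; apply: subsetUr. Qed.

Lemma first_gain_ge0 B h : 0 <= first_gain B h.
Proof. by elim: h => [|[e c] h IH] //=; case: ifP => // _; apply: marg_ge0. Qed.

(* Greedy gains decrease over time, so the first gain inside [B] dominates
   all later ones. *)
Lemma marg_le_first_gain B h x : greedy h -> seen h :&: B != set0 ->
  x \in avail h -> marg f (heads h) x <= first_gain B h.
Proof.
elim: h x => [|[e c] h IH] x /=; first by rewrite seen_nil set0I eqxx.
move=> [E gh] sB xA; have xA' := avail_cons xA.
apply: le_trans (marg_cons _ _ _ _) _.
case: ifPn => [_|first]; first exact: next_max E xA'.
apply: IH => //; move: first; rewrite negb_and; case: (boolP (e \in B)) => //= eB _.
move: sB; rewrite seen_cons setIUl (_ : [set e] :&: B = set0) ?set0U //.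
by apply/eqP; rewrite setI_eq0 disjoints1.
Qed.

Lemma card_tails_cons B e h : e \notin seen h ->
  #|tails ((e, false) :: h) :&: B| = ((e \in B) + #|tails h :&: B|)%N.
Proof.
rewrite in_setU negb_or => /andP[_ et]; rewrite tails_cons.
case: (boolP (e \in B)) => eB.
  have -> : (e |: tails h) :&: B = e |: (tails h :&: B).
    by rewrite setIUl (setIidPl _) ?sub1set.
  by rewrite cardsU1 in_setI (negPf et).
rewrite setIUl (_ : [set e] :&: B = set0) ?set0U //.
by apply/eqP; rewrite setI_eq0 disjoints1.
Qed.

Lemma card_heads_cons B e h : e \notin seen h ->
  #|heads ((e, true) :: h) :&: B| = ((e \in B) + #|heads h :&: B|)%N.
Proof.
rewrite in_setU negb_or => /andP[eh _]; rewrite heads_cons.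
case: (boolP (e \in B)) => eB.
  have -> : (e |: heads h) :&: B = e |: (heads h :&: B).
    by rewrite setIUl (setIidPl _) ?sub1set.
  by rewrite cardsU1 in_setI (negPf eh).
rewrite setIUl (_ : [set e] :&: B = set0) ?set0U //.
by apply/eqP; rewrite setI_eq0 disjoints1.
Qed.

Lemma tails_gain_le B h : greedy h ->
  gain (fun e c => ~~ c && (e \in B)) h <= first_gain B h * #|tails h :&: B|%:R.
Proof.
elim: h => [|[e c] h IH] /=; first by rewrite /gain tails_nil set0I cards0 mulr0.
move=> [E gh]; have [_ es _] := next_avail E; have {}IH := IH gh.
have eA : e \in avail h by have /next_SomeP[] := E.
have tail0 : seen h :&: B = set0 -> tails h :&: B = set0.
  by move=> s0; apply/eqP; rewrite -subset0 -s0 setSI // subsetUr.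
rewrite gain_cons /=.
have := first_gain_ge0 B h; have := marg_ge0 fmono (heads h) e.
case: c => /=; last first.
  rewrite card_tails_cons //; case: (boolP (e \in B)) => eB /=; last first.
    by rewrite mul0r !add0r.
  case: ifPn => [/eqP s0|sB].
    by move: IH; rewrite (tail0 s0) cards0 mulr0 addn0 mul1r mulr1; lra.
  have := @marg_le_first_gain B h e gh sB eA.
  by move: IH; rewrite mul1r add1n mulrSr mulrDr mulr1; lra.
rewrite mul0r add0r tails_cons.
case: ifPn => [/andP[_ /eqP s0]|_] //.
by move: IH; rewrite (tail0 s0) cards0 !mulr0.
Qed.

(* The drift of [tail_gain setT h] is [q b], where [b] is the marginal value of
   the examined element over everything seen; the drift of
   [f (seen h) - f (heads h)] is [b - p a], with [a] the marginal value over the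
   heads.  Eliminating [b] leaves [p q a]. *)
Lemma Ex_tail_gain p n : 0 <= p <= 1 ->
  (1 - p) * p * Ex p (fun H => gain (fun _ _ => true) (run I f setT n H [::]))
  <= Ex p (fun H => tail_gain setT (run I f setT n H [::])).
Proof.
move=> hp; rewrite -subr_ge0 -ExZ -ExB.
pose Phi h := tail_gain setT h - (1 - p) * p * gain (fun _ _ => true) h
  - (1 - p) * (f (seen h) - f (heads h)).
apply: (@le_trans _ _ (Ex p (fun H => Phi (run I f setT n H [::])))).
  have <- : Phi [::] = 0.
    by rewrite /Phi seen_nil heads_nil /tail_gain /gain /=; ring.
  apply: (Ex_run_ge (I := I) (f := f) (V := setT)) => // h e gh E.
  rewrite /Phi !tail_gain_cons !gain_cons in_setT.
  rewrite !seen_cons !heads_cons /marg /=.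
  by rewrite le_eqVlt; apply/orP; left; apply/eqP; ring.
apply: le_Ex => // H; rewrite /Phi lerBlDr lerDl mulr_ge0 ?subr_ge0.
- by [].
- by case/andP: hp.
by apply: fmono; apply: subsetUl.
Qed.

Lemma f_heads_le h : f (heads h) - f set0 <= gain (fun _ _ => true) h.
Proof.
elim: h => [|[e c] h IH]; first by rewrite heads_nil subrr.
rewrite gain_cons mul1r heads_cons.
have := marg_ge0 fmono (heads h) e; move: IH; rewrite /marg; case: c => /=; lra.
Qed.

Lemma f_tails_ge X h : f set0 + tail_gain X h <= f (tails h :&: X).
Proof.
elim: h => [|[e c] h IH]; first by rewrite tails_nil set0I addr0.
rewrite tail_gain_cons tails_cons.
case: c => /=; first by rewrite mul0r add0r.
case: (boolP (e \in X)) => eX; last first.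
  by rewrite mul0r add0r (le_trans IH) // fmono // setSI // subsetUr.
rewrite mul1r setIUl; have -> : [set e] :&: X = [set e].
  by apply/setIidPl; rewrite sub1set.
have := @marg_anti _ _ f fmono fsub (tails h :&: X) (seen h) e.
rewrite (subset_trans (subsetIl _ _) (subsetUr _ _)) => /(_ isT).
move: IH; rewrite /marg; lra.
Qed.

(** A tail outside [X] lies in some [B j], whose sum counts it with its marginal over the heads;
    this is at least its marginal over all seen elements. *)
Lemma tail_gain_split (J : finType) (P : pred J) (B : J -> {set U}) X h :
  ~: X \subset \bigcup_(j | P j) B j ->
  tail_gain setT h - \sum_(j | P j) gain (fun e c => ~~ c && (e \in B j)) h
  <= tail_gain X h.
Proof.
move=> /subsetP cov; elim: h => [|[e c] h IH].
  by rewrite /tail_gain /gain /= big1 ?subrr.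
rewrite !tail_gain_cons (eq_bigr _ (fun j _ => gain_cons _ e c h)) big_split /=.
rewrite in_setT andbT.
case: c => /=.
  by rewrite big1 => [|j _]; rewrite ?mul0r // !add0r.
suff : marg f (seen h) e - \sum_(j | P j) (e \in B j)%:R * marg f (heads h) e
     <= (e \in X)%:R * marg f (seen h) e.
  by move: IH; lra.
case: (boolP (e \in X)) => eX.
  rewrite mul1r lerBlDr lerDl sumr_ge0 // => j _.
  by rewrite mulr_ge0 ?ler0n // marg_ge0.
have /cov/bigcupP[j Pj eB] : e \in ~: X by rewrite inE.
rewrite mul0r subr_le0 (bigD1 j) //= eB mul1r.
apply: (@le_trans _ _ (marg f (heads h) e)).
  by apply: marg_anti => //; apply: subsetUl.
rewrite lerDl sumr_ge0 // => i _.
by rewrite mulr_ge0 ?ler0n // marg_ge0.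
Qed.

(* An exponential supermartingale for the number of tails in [B], started when
   [B] is first hit. *)
Lemma Ex_overflow p n B (y z K : R) :
  0 <= p <= 1 -> 0 <= y -> 0 <= z -> 0 <= K -> p * y + (1 - p) * z <= 1 ->
  Ex p (fun H => let h := run I f setT n H [::] in
    first_gain B h * K * z ^+ #|tails h :&: B| * y ^+ #|heads h :&: B|)
  <= K * Ex p (fun H => gain (fun e _ => e \in B) (run I f setT n H [::])).
Proof.
move=> hp y0 z0 K0 pyz.
(* [Psi] is 0 until [B] is hit. The first hit brings in at most [K] times the gain on average;
   afterwards a head in [B] multiplies by [y] and a tail by [z], a mean factor of at most 1. *)
pose Psi h := first_gain B h * K * z ^+ #|tails h :&: B| * y ^+ #|heads h :&: B|.
have Psi0 h : 0 <= Psi h by rewrite /Psi !mulr_ge0 ?exprn_ge0 ?first_gain_ge0.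
pose Phi h := K * gain (fun e _ => e \in B) h - Psi h.
have Phi0 : Phi [::] = 0 by rewrite /Phi /Psi /gain /= mulr0 !mul0r subrr.
have : Phi [::] <= Ex p (fun H => Phi (run I f setT n H [::])).
  apply: (Ex_run_ge (I := I) (f := f) (V := setT)) => // h e gh E.
  have [_ es _] := next_avail E.
  rewrite /Phi !gain_cons.
  suff : p * Psi ((e, true) :: h) + (1 - p) * Psi ((e, false) :: h)
       <= Psi h + K * ((e \in B)%:R * marg f (heads h) e) by lra.
  rewrite {1 2}/Psi card_tails_cons // card_heads_cons // heads_cons tails_cons /=.
  have m0 := marg_ge0 fmono (heads h) e.
  case: (boolP (e \in B)) => eB /=; last first.
    by rewrite !add0n /Psi le_eqVlt; apply/orP; left; apply/eqP; ring.
  rewrite !add1n !exprS mul1r; case: ifPn => [/eqP s0|_].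
    have -> : tails h :&: B = set0.
      by apply/eqP; rewrite -subset0 -s0 setSI // subsetUr.
    have -> : heads h :&: B = set0.
      by apply/eqP; rewrite -subset0 -s0 setSI // subsetUl.
    rewrite cards0 !expr0 !mulr1.
    have : marg f (heads h) e * K * (p * y + (1 - p) * z) <= marg f (heads h) e * K.
      by rewrite ler_piMr // mulr_ge0.
    have := Psi0 h; lra.
  have : Psi h * (p * y + (1 - p) * z) <= Psi h by rewrite ler_piMr.
  have : 0 <= K * marg f (heads h) e by rewrite mulr_ge0.
  rewrite /Psi; lra.
by rewrite Phi0 ExB ExZ subr_ge0.
Qed.

(* The excess capacity [k |heads| - |stuck|] is charged at any value [v] below the
   gains so far. *)
Lemma greedy_charge (k : nat) T h (v : R) :
  (forall M Z : {set U}, I M -> Z \subset T :\: M ->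
    (forall o, o \in Z -> ~~ I (o |: M)) -> (#|Z| <= k * #|M|)%N) ->
  greedy h -> 0 <= v ->
  (forall h1 e c h2, h = h1 ++ (e, c) :: h2 -> v <= marg f (heads h2) e) ->
  \sum_(o in stuck T h) marg f (heads h) o
    + ((k * #|heads h|)%:R - #|stuck T h|%:R) * v
  <= k%:R * (f (heads h) - f set0).
Proof.
move=> exch; elim: h v => [|[e c] h IH] v gh v0 vle; set Z := stuck T _.
  have Z0 : Z = set0.
    apply/eqP; rewrite -cards_eq0 -leqn0; have := exch set0 Z I0.
    rewrite cards0 muln0; apply.
      by apply/subsetP => o; rewrite inE seen_nil => /andP[].
    by move=> o; rewrite inE heads_nil => /andP[].
  by rewrite Z0 heads_nil big_set0 !cards0 muln0; lra.
have {gh} [E gh] : gnext h = Some e /\ greedy h by [].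
have va : v <= marg f (heads h) e by apply: (vle [::] e c h).
have a0 := marg_ge0 fmono (heads h) e.
have [_ es eI] := next_avail E.
pose Y := stuck T h.
rewrite /Z {Z}; case: c vle => vle; set Z := stuck T _; last first.
  have ZY : Z \subset Y.
    apply/subsetP => o; rewrite ![o \in stuck _ _]in_set !in_setD seen_cons heads_cons.
    by rewrite in_setU1 negb_or -andbA => /and3P[/andP[_ ->] -> ->].
  have YZ : Y \subset Z.
    apply/subsetP => o; rewrite ![o \in stuck _ _]in_set !in_setD seen_cons heads_cons.
    rewrite in_setU1 negb_or => /andP[/andP[-> ->] nI]; rewrite nI !andbT.
    by apply: contraNneq nI => ->.
  have -> : Z = Y by apply/eqP; rewrite eqEsubset ZY YZ.
  rewrite heads_cons; apply: IH => // h1 e' c' h2 eh.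
  by apply: (vle ((e, false) :: h1) e' c' h2); rewrite eh.
(* The induction hypothesis is used with the current gain in place of [v]: gains decrease along the
   history, so all earlier ones are at least this one. *)
have {}IH := IH (marg f (heads h) e) gh a0.
have {}IH : \sum_(o in Y) marg f (heads h) o
   + ((k * #|heads h|)%:R - #|Y|%:R) * marg f (heads h) e
  <= k%:R * (f (heads h) - f set0).
  apply: IH => h1 e' c' h2 eh.
  have eA : e \in avail h by have /next_SomeP[] := E.
  elim: h1 h eh gh {E va a0 es eI Y Z vle} eA => [|[e1 c1] h1 IH1] h -> /= [E gh] eA.
    apply: le_trans (marg_cons _ _ _ _) _; apply: next_max E _.
    exact: avail_cons eA.
  apply: le_trans (marg_cons _ _ _ _) _; apply: IH1 => //.
  exact: avail_cons eA.
have YZ : Y \subset Z.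
  apply/subsetP => o; rewrite ![o \in stuck _ _]in_set !in_setD seen_cons heads_cons.
  rewrite in_setU1 negb_or => /andP[/andP[-> ->] nI]; rewrite !andbT; apply/andP; split.
    by apply: contraNneq nI => ->.
  by apply: contra nI; apply: Isub; apply: setUS; apply: subsetUr.
have cZ : (#|Z| <= k * #|heads ((e, true) :: h)|)%N.
  apply: exch; first by rewrite heads_cons.
    apply/subsetP => o; rewrite in_set => /andP[+ _].
    by rewrite !in_setD => /andP[+ ->]; rewrite in_setU negb_or => /andP[->].
  by move=> o; rewrite in_set => /andP[].
have cH : #|heads ((e, true) :: h)| = #|heads h|.+1.
  by rewrite heads_cons cardsU1; move: es; rewrite in_setU negb_or => /andP[-> _].
(* A newly stuck element was available when [e] was chosen, so its marginal value is at most that of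
   [e]. *)
have sumZ : \sum_(o in Z) marg f (heads ((e, true) :: h)) o
   <= \sum_(o in Y) marg f (heads h) o + (#|Z|%:R - #|Y|%:R) * marg f (heads h) e.
  rewrite -natrB ?subset_leq_card // -cardsDS // mulrC mulr_natr -sumr_const.
  rewrite (big_setID Y) /= (setIidPr YZ); apply: lerD; apply: ler_sum => o.
    by move=> _; apply: marg_cons.
  move=> oZY; apply: le_trans (marg_cons _ _ _ _) _; apply: next_max E _.
  move: oZY; rewrite in_setD ![o \in stuck _ _]in_set !in_setD seen_cons in_setU1 negb_or
    [o \in avail _]in_set in_setT.
  by move=> /andP[+ /andP[/andP[/andP[_ os] oT] _]]; rewrite os oT /= negbK.
(* By [cZ] the excess is non-negative, so [v] may be raised to the gain of [e]. *)
have : ((k * #|heads ((e, true) :: h)|)%:R - #|Z|%:R) * v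
   <= ((k * #|heads ((e, true) :: h)|)%:R - #|Z|%:R) * marg f (heads h) e.
  by rewrite ler_wpM2l // subr_ge0 ler_nat.
move: sumZ IH; rewrite cH mulnS natrD heads_cons.
have -> : f (e |: heads h) = f (heads h) + marg f (heads h) e by rewrite /marg; lra.
lra.
Qed.

(** Once nothing is available, the elements of [T] outside heads and tails are all stuck, so the
    charge with [v = 0] bounds the sum of their marginal values over the heads. *)
Lemma greedy_approx (k : nat) T h :
  (forall M Z : {set U}, I M -> Z \subset T :\: M ->
    (forall o, o \in Z -> ~~ I (o |: M)) -> (#|Z| <= k * #|M|)%N) ->
  greedy h -> gnext h = None ->
  f (T :\: tails h) <= k.+1%:R * f (heads h) - k%:R * f set0.
Proof.
move=> exch gh /next_NoneP A0.
have := @greedy_charge k T h 0 exch gh (lexx _) (fun _ _ _ _ _ => marg_ge0 fmono _ _).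
rewrite mulr0 addr0 => charge.
apply: le_trans (le_sum_marg fmono fsub (heads h) _) _.
apply: (@le_trans _ _ (f (heads h) + k%:R * (f (heads h) - f set0))); last first.
  by rewrite -natr1; lra.
rewrite lerD2l; apply: le_trans charge; rewrite le_eqVlt; apply/orP; left; apply/eqP.
apply: eq_bigl => o; rewrite [RHS]in_set !in_setD /seen in_setU negb_or.
case: (boolP (o \in heads h)) => //= oh; case: (boolP (o \in tails h)) => //= ot.
case: (o \in T) => //=; apply/esym; apply: contraT; rewrite negbK => oI.
by have := in_set0 o; rewrite -A0 in_set in_setT /seen in_setU negb_or oh ot oI.
Qed.

End Gains.

(** * Laminar families *)

(** Induction on the number of members: a largest member [B] absorbs those inside it, and laminarity
    makes all others disjoint from [B], so the counts add up. *)
Lemma laminar_cover_le (U : finType) (G : {set {set U}}) (T M : {set U}) :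
  laminar G -> (forall B, B \in G -> (#|T :&: B| <= #|M :&: B|)%N) ->
  (#|T :&: cover G| <= #|M :&: cover G|)%N.
Proof.
have [n] := ubnP #|G|; elim: n G => // n IH G cG lam le_B.
have [->|[B0 B0G]] := set_0Vmem G.
  by rewrite /cover big_set0 !setI0.
case: (@arg_maxnP _ B0 (mem G) (fun A => #|A|) B0G) => B BG Bmax.
pose G' := [set A in G | ~~ (A \subset B)].
have sG : G' \subset G by apply/subsetP => A; rewrite inE => /andP[].
have disj A : A \in G' -> [disjoint A & B].
  rewrite inE => /andP[AG nAB]; have /or3P[] := lam A B AG BG => // sub.
    by rewrite sub in nAB.
  have /eqP AB : A == B by rewrite eq_sym eqEcard sub /=; apply: Bmax.
  by rewrite AB subxx in nAB.
have coverE : cover G = B :|: cover G'.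
  apply/setP => x; rewrite in_setU; apply/bigcupP/orP => [[A AG xA]|].
    have [AB|nAB] := boolP (A \subset B); first by left; apply: (subsetP AB).
    by right; apply/bigcupP; exists A; rewrite // inE AG.
  case=> [xB|/bigcupP[A AG' xA]]; first by exists B.
  by exists A => //; apply: (subsetP sG).
have cardE (S : {set U}) : #|S :&: cover G| = (#|S :&: B| + #|S :&: cover G'|)%N.
  rewrite coverE setIUr cardsU (_ : S :&: B :&: _ = set0) ?cards0 ?subn0 //.
  apply/setP => x; rewrite !inE; apply/negP => /andP[/andP[_ xB] /andP[_]].
  move=> /bigcupP[A /disj AB xA].
  by rewrite (disjointFr AB xA) in xB.
rewrite !cardE; apply: leq_add; first exact: le_B.
apply: IH => //.
- rewrite -ltnS; apply: leq_trans _ cG; rewrite ltnS.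
  apply: proper_card; apply/properP; split=> //.
  by exists B; rewrite // inE subxx andbF.
- by move=> A C /(subsetP sG) AG /(subsetP sG) CG; apply: lam.
by move=> A /(subsetP sG); apply: le_B.
Qed.

Lemma card_bigcup_le (U J : finType) (A : J -> {set U}) :
  (#|\bigcup_j A j| <= \sum_j #|A j|)%N.
Proof.
elim/big_rec2: _ => [|j n S _ le_S]; first by rewrite cards0.
by apply: leq_trans (leq_card_setU _ _) _; rewrite leq_add2l.
Qed.

Section Laminar.
Variables (U : finType) (k : nat) (F : 'I_k -> {set {set U}}).
Variable mu : 'I_k -> {set U} -> nat.
Hypothesis hlam : forall i, laminar (F i).

Definition indepb : pred {set U} :=
  fun T => [forall i, [forall (B | B \in F i), (#|T :&: B| <= mu i B)%N]].

Lemma indepP T : reflect (indep_k F mu T) (indepb T).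
Proof.
apply: (iffP forallP) => [h i B BF|h i]; last by apply/forall_inP => B; apply: h.
by have /forall_inP := h i; apply.
Qed.

Lemma indepb0 : indepb set0.
Proof. by apply/indepP => i B _; rewrite set0I cards0. Qed.

Lemma indepb_sub (S T : {set U}) : S \subset T -> indepb T -> indepb S.
Proof.
move=> sST /indepP IT; apply/indepP => i B BF.
by apply: leq_trans _ (IT i B BF); rewrite subset_leq_card // setSI.
Qed.

(** A stuck element lies in a constraint of some matroid that [M] already fills. Within one matroid,
    the filled constraints together contain at most as many elements of [T] as of [M], hence at most
    [#|M|]. *)
Lemma laminar_exchange (T M Z : {set U}) : indepb T -> indepb M ->
  Z \subset T :\: M -> (forall o, o \in Z -> ~~ indepb (o |: M)) ->
  (#|Z| <= k * #|M|)%N.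
Proof.
move=> /indepP IT /indepP IM ZT Zstuck.
pose G i := [set B in F i | (mu i B <= #|M :&: B|)%N].
have sG i : G i \subset F i by apply/subsetP => B; rewrite inE => /andP[].
apply: (@leq_trans #|\bigcup_i (T :&: cover (G i))|).
  apply: subset_leq_card; apply/subsetP => o oZ.
  have := subsetP ZT o oZ; rewrite inE => /andP[oM oT].
  have := Zstuck o oZ; rewrite negb_forall => /existsP[i].
  rewrite negb_forall_in => /exists_inP[B BF]; rewrite -ltnNge => lt_mu.
  have oB : o \in B.
    apply: contraLR lt_mu => oB; rewrite -leqNgt setIUl.
    rewrite (_ : [set o] :&: B = set0) ?set0U ?IM //.
    by apply/eqP; rewrite setI_eq0 disjoints1.
  apply/bigcupP; exists i => //; rewrite inE oT; apply/bigcupP; exists B => //.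
  rewrite inE BF -ltnS; apply: leq_trans lt_mu _; rewrite setIUl.
  apply: leq_trans (leq_card_setU _ _) _.
  by rewrite -add1n leq_add2r -(cards1 o) subset_leq_card // subsetIl.
apply: leq_trans (card_bigcup_le _) _.
apply: (@leq_trans (\sum_(i < k) #|M|)%N); last by rewrite sum_nat_const card_ord.
apply: leq_sum => i _.
apply: leq_trans (laminar_cover_le (M := M) _ _) _.
- by move=> A B /(subsetP (sG i)) + /(subsetP (sG i)); apply: hlam.
- by move=> B; rewrite inE => /andP[BF]; apply: leq_trans; apply: IT.
by rewrite subset_leq_card // subsetIl.
Qed.

(* Among the constraints of equal capacity only the maximal ones matter. *)
Definition ess i : {set {set U}} :=
  [set B in F i | [forall (A | A \in F i),
    ((B \subset A) && (mu i A == mu i B)) ==> (A == B)]].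

Lemma ess_above i B : B \in F i ->
  exists A, [/\ A \in ess i, B \subset A & mu i A = mu i B].
Proof.
move=> BF; pose Q (A : {set U}) := [&& A \in F i, B \subset A & mu i A == mu i B].
have QB : Q B by rewrite /Q BF subxx eqxx.
case: (@arg_maxnP _ B Q (fun A => #|A|) QB) => A /and3P[AF BA /eqP muA] Amax.
exists A; split=> //; rewrite inE AF; apply/forall_inP => C CF.
apply/implyP => /andP[sAC /eqP muC]; rewrite eq_sym eqEcard sAC /=.
by apply: Amax; rewrite /Q CF (subset_trans BA sAC) muC muA eqxx.
Qed.

Lemma ess_inj i e A B : A \in ess i -> B \in ess i -> e \in A -> e \in B ->
  mu i A = mu i B -> A = B.
Proof.
rewrite !inE => /andP[AF /forall_inP maxA] /andP[BF /forall_inP maxB] eA eB muE.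
have /or3P[AB|BA|dAB] := hlam AF BF.
- by apply/esym/eqP/(implyP (maxA B BF)); rewrite AB muE eqxx.
- by apply/eqP/(implyP (maxB A AF)); rewrite BA muE eqxx.
by rewrite (disjointFr dAB eA) in eB.
Qed.

(** * Geometric weights indexed by capacity *)

Variable R : realFieldType.

Definition capw (j : nat) : R := (20 * k%:R)^-1 * (5 * k%:R)^-1 ^+ j.

Lemma geometric_le (x : R) n : 0 <= x <= 1 / 5 ->
  \sum_(j < n) x ^+ j.+1 <= 5 / 4 * x.
Proof.
move=> /andP[x0 x5]; elim: n => [|n IH]; first by rewrite big_ord0; lra.
rewrite big_ord_recl expr1.
have -> : \sum_(i < n) x ^+ (lift ord0 i).+1 = x * \sum_(i < n) x ^+ i.+1.
  by rewrite mulr_sumr; apply: eq_bigr => i _; rewrite -exprS.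
have : x * \sum_(i < n) x ^+ i.+1 <= x * (1 / 4) by rewrite ler_wpM2l //; lra.
lra.
Qed.

Lemma capw_ge0 j : 0 <= capw j.
Proof. by rewrite /capw mulr_ge0 ?exprn_ge0 ?invr_ge0 ?mulr_ge0 ?ler0n. Qed.

(** Essential constraints of one matroid through [e] have distinct capacities, by laminarity, and
    these are positive because [[set e]] is independent. What remains is a geometric series starting
    at exponent 1. *)
Lemma sum_capw i e : (0 < k)%N -> indepb [set e] ->
  \sum_(B in ess i | e \in B) capw (mu i B) <= (80 * k%:R ^+ 2)^-1.
Proof.
move=> k0 /indepP Ie.
have kR : 1 <= k%:R :> R by rewrite ler1n.
pose n := (\max_(B : {set U}) mu i B).+1.
have ltn_mu B : (mu i B < n)%N by rewrite ltnS leq_bigmax.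
rewrite (partition_big (fun B => Ordinal (ltn_mu B)) predT) //=.
apply: (@le_trans _ _ (\sum_(j < n) if (0 < j)%N then capw j else 0)).
  apply: ler_sum => j _.
  case: (pickP (fun B => (B \in ess i) && (e \in B) && (mu i B == j))) => [B|none].
    move=> /andP[/andP[Be eB] /eqP muB].
    rewrite (bigD1 B) /=; last first.
      by rewrite Be eB; apply/eqP/val_inj.
    rewrite big1 ?addr0; last first.
      move=> A /andP[/andP[/andP[Ae eA] /eqP/(congr1 val)/= muA] /eqP nAB].
      by case: nAB; apply: (ess_inj Ae Be eA eB); rewrite muA muB.
    rewrite muB ifT // -muB.
    have BF : B \in F i by move: Be; rewrite inE => /andP[].
    apply: leq_trans _ (Ie i B BF); rewrite card_gt0; apply/set0Pn; exists e.
    by rewrite !inE eqxx eB.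
  rewrite big1; first by case: ifP => // _; apply: capw_ge0.
  move=> B /andP[BeB /eqP/(congr1 val)/= muB].
  by have := none B; rewrite BeB muB eqxx.
rewrite big_ord_recl /= add0r.
rewrite /capw -mulr_sumr.
apply: (@le_trans _ _ ((20 * k%:R)^-1 * (5 / 4 * (5 * k%:R)^-1))).
  rewrite ler_wpM2l ?invr_ge0 ?mulr_ge0 ?ler0n //; apply: geometric_le.
  rewrite invr_ge0 mulr_ge0 ?ler0n //= div1r lef_pV2 ?posrE; lra.
by rewrite le_eqVlt; apply/orP; left; apply/eqP; field; lra.
Qed.

(** Here [t] counts tails, [i] heads, and [m] is the capacity. Since [2 * t <= 2 ^ t], the base
    [20 * k] leaves at least [(10 * k) ^ m.+1], which contains a factor [2 ^ m] to pay for the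
    heads. *)
Lemma capw_overflow (t i m : nat) : (0 < k)%N -> (m < t)%N -> (i <= m)%N ->
  t%:R <= capw m * (20 * k%:R) ^+ t * 2^-1 ^+ i :> R.
Proof.
move=> k0 lt_mt le_im.
have kR : 1 <= k%:R :> R by rewrite ler1n.
have le2 : (t * 2 <= 2 ^ t)%N.
  by elim: t {lt_mt le_im} => // -[|t] IH //; rewrite expnS; lia.
have : (t * (20 * k * (5 * k) ^ m * 2 ^ i) <= (20 * k) ^ t)%N.
  rewrite (_ : 20 * k = 2 * (10 * k))%N; last by lia.
  rewrite [((2 * _) ^ t)%N]expnMn.
  apply: (@leq_trans (2 ^ t * (10 * k) ^ m.+1)%N).
    rewrite expnS -[in X in (_ <= X)%N](_ : (2 * (5 * k) = 10 * k)%N); last by lia.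
    rewrite [((2 * (5 * k)) ^ m)%N]expnMn.
    have : (2 ^ i <= 2 ^ m)%N by rewrite leq_exp2l.
    move: le2; set a := (2 ^ t)%N; set b := (2 ^ i)%N; set c := (2 ^ m)%N.
    set d := ((5 * k) ^ m)%N => le2 le_bc.
    have := leq_mul (leq_mul le2 le_bc) (leqnn (10 * k * d)).
    by lia.
  by rewrite leq_mul2l leq_pexp2l ?orbT //; lia.
rewrite -(ler_nat R) !(natrM, natrX) => le_R.
rewrite /capw !exprVn; set u := (20 * k%:R) in le_R *; set v := (_ ^+ m) in le_R *.
have u0 : 0 < u by rewrite /u; lra.
have v0 : 0 < v by rewrite exprn_gt0 //; lra.
have w0 : 0 < 2 ^+ i :> R by rewrite exprn_gt0.
rewrite (_ : _ * _ * _ * _ = u ^+ t / (u * v * 2 ^+ i)); last by field; rewrite !gt_eqF.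
by rewrite ler_pdivlMr ?mulr_gt0 //; lra.
Qed.

End Laminar.

(** * Value of the surviving candidates *)

Section Value.
Variables (R : realType) (U : finType) (k : nat) (F : 'I_k -> {set {set U}}).
Variable mu : 'I_k -> {set U} -> nat.
Hypothesis hlam : forall i, laminar (F i).
Hypothesis k0 : (0 < k)%N.

Local Notation I := (indepb F mu).

Definition coin : R := 1 - (40 * k%:R)^-1.

Definition uncrowded (N : {set U}) : {set U} :=
  [set e | [forall i, [forall (B | B \in F i),
    (e \in B) ==> (#|N :&: B| <= mu i B)%N]]].

(** The hindsight version, run on the whole ground set; the online test agrees with it outside the
    sample. *)
Definition candidates (f : {set U} -> R) (H : {set U}) : {set U} :=
  tails (run I f setT #|U| H [::]).

Variable f : {set U} -> R.
Hypothesis vf : valid_fun f.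

Let f0 : forall S : {set U}, 0 <= f S. Proof. by case: vf. Qed.
Let fmono : forall S T : {set U}, S \subset T -> f S <= f T.
Proof. by case: vf. Qed.
Let fsub : forall S T : {set U}, f (S :|: T) + f (S :&: T) <= f S + f T.
Proof. by case: vf. Qed.

Local Notation all_gain := (gain f (fun _ _ => true)).
Local Notation hist H := (run I f setT #|U| H [::]).
Local Notation essp := (fun j : 'I_k * {set U} => j.2 \in ess F mu j.1).

Let kR : 1 <= k%:R :> R. Proof. by rewrite ler1n. Qed.

Let invk : 0 < (k%:R : R)^-1 <= 1.
Proof. by have k1 := kR; rewrite invr_gt0 invf_le1; lra. Qed.

Let coinE : coin = 1 - k%:R^-1 / 40.
Proof. by have k1 := kR; rewrite /coin; field; lra. Qed.

Lemma coin01 : 0 <= coin <= 1.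
Proof. by have u1 := invk; rewrite coinE; lra. Qed.

Definition overflow_pot (j : 'I_k * {set U}) h : R :=
  first_gain f j.2 h * capw k R (mu j.1 j.2)
    * (20 * k%:R) ^+ #|tails h :&: j.2| * 2^-1 ^+ #|heads h :&: j.2|.

Lemma Ex_overflow_pot j : Ex coin (fun H => overflow_pot j (hist H))
  <= capw k R (mu j.1 j.2) * Ex coin (fun H => gain f (fun e _ => e \in j.2) (hist H)).
Proof.
have k1 := kR; have u1 := invk.
apply: Ex_overflow => //; first exact: coin01.
- by lra.
- by lra.
- exact: capw_ge0.
(* The mean factor is [p / 2 + 20 k q], and [20 k q] is exactly [1 / 2]. *)
rewrite coinE; have -> : (1 - (1 - k%:R^-1 / 40)) * (20 * k%:R) = 2^-1 :> R.
  by field; lra.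
lra.
Qed.

Lemma le_overflow_pot j h : j.2 \in F j.1 -> greedy_hist I f setT h ->
  (mu j.1 j.2 < #|tails h :&: j.2|)%N ->
  gain f (fun e c => ~~ c && (e \in j.2)) h <= overflow_pot j h.
Proof.
move=> jF gh over.
apply: le_trans (tails_gain_le (@indepb_sub _ _ F mu) fmono fsub _ gh) _.
have -> : overflow_pot j h = first_gain f j.2 h * (capw k R (mu j.1 j.2)
    * (20 * k%:R) ^+ #|tails h :&: j.2| * 2^-1 ^+ #|heads h :&: j.2|).
  by rewrite /overflow_pot; ring.
rewrite ler_wpM2l ?first_gain_ge0 //.
apply: capw_overflow => //.
have /indepP := greedy_indep (indepb0 F mu) gh; exact.
Qed.

Lemma overflow_pot_ge0 j h : 0 <= overflow_pot j h.
Proof.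
have k1 := kR; have Kge0 := capw_ge0 k R (mu j.1 j.2).
apply: mulr_ge0; last by apply: exprn_ge0; lra.
apply: mulr_ge0; last by apply: exprn_ge0; lra.
by apply: mulr_ge0 => //; apply: first_gain_ge0.
Qed.

(** Summing per examined element instead of per constraint, each of the [k] matroids contributes at
    most [1 / (80 k^2)] times the gain of that element. *)
Lemma sum_ess_gain h : greedy_hist I f setT h ->
  \sum_(j | essp j) capw k R (mu j.1 j.2) * gain f (fun e _ => e \in j.2) h
  <= (80 * k%:R)^-1 * all_gain h.
Proof.
elim: h => [|[e c] h IH] gh.
  by rewrite mulr0 big1 // => j _; rewrite /gain /= mulr0.
have {gh} [E gh] : gnext I f setT h = Some e /\ greedy_hist I f setT h by [].
have [_ _ eI] := next_avail E.
have Ie : I [set e] by apply: indepb_sub eI; apply: subsetUl.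
rewrite gain_cons mul1r mulrDr.
under eq_bigr => j _ do rewrite gain_cons mulrDr.
rewrite big_split /=; apply: lerD; last exact: IH.
have m0 := marg_ge0 fmono (heads h) e.
under eq_bigr => j _ do rewrite mulrA.
rewrite -mulr_suml ler_wpM2r //.
have -> : \sum_(j | essp j) capw k R (mu j.1 j.2) * (e \in j.2)%:R
    = \sum_(i < k) \sum_(B in ess F mu i | e \in B) capw k R (mu i B).
  rewrite (pair_big_dep predT (fun i B => (B \in ess F mu i) && (e \in B))) /=.
  rewrite [RHS]big_mkcondr /=; apply: eq_bigr => j _.
  by case: (e \in j.2); rewrite ?mulr1 ?mulr0.
apply: (@le_trans _ _ (\sum_(i < k) (80 * k%:R ^+ 2)^-1)).
  by apply: ler_sum => i _; apply: sum_capw.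
have k1 := kR; rewrite sumr_const card_ord -mulr_natr le_eqVlt; apply/orP; left; apply/eqP.
by field; lra.
Qed.

(** An element in an exceeded constraint is also in the essential one above it, which has the same
    capacity and is exceeded as well; the potential of the latter pays for the loss. *)
Lemma f_uncrowded_ge H :
  f set0 + tail_gain f setT (hist H) - \sum_(j | essp j) overflow_pot j (hist H)
  <= f (candidates f H :&: uncrowded (candidates f H)).
Proof.
set N := candidates f H; set h := hist H.
have gh : greedy_hist I f setT h by apply: greedy_run.
apply: le_trans (f_tails_ge fmono fsub _ _).
rewrite -addrA lerD2l.
pose over j := (mu j.1 j.2 < #|N :&: j.2|)%N.
have cov : ~: uncrowded N \subset
    \bigcup_(j : 'I_k * {set U} | essp j && over j) j.2.
  apply/subsetP => e; rewrite !inE negb_forall => /existsP[i].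
  rewrite negb_forall_in => /exists_inP[B BF]; rewrite negb_imply -ltnNge.
  move=> /andP[eB ov]; have [A [Ae BA muA]] := ess_above mu BF.
  apply/bigcupP; exists (i, A); last exact: (subsetP BA).
  rewrite /over /= Ae muA /=; apply: leq_trans ov _.
  by rewrite subset_leq_card // setIS.
apply: le_trans (tail_gain_split fmono fsub h cov).
rewrite lerD2l lerN2 [X in _ <= X](bigID over) /=.
rewrite -[X in X <= _]addr0; apply: lerD; last first.
  by apply: sumr_ge0 => j _; apply: overflow_pot_ge0.
apply: ler_sum => j /andP[je ov]; apply: le_overflow_pot => //.
by move: je; rewrite inE => /andP[].
Qed.

Lemma Ex_heads_ge T : indep_k F mu T ->
  coin * (f T - f set0)
  <= (k.+1)%:R * (Ex coin (fun H => f (heads (hist H))) - f set0).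
Proof.
move=> /indepP IT.
have leH H : f (T :&: H) <= k.+1%:R * f (heads (hist H)) - k%:R * f set0.
  apply: (@le_trans _ _ (f (T :\: tails (hist H)))).
    apply: fmono; rewrite setDE setIS // -disjoints_subset disjoint_sym.
    by apply: run_tails; rewrite tails_nil -setI_eq0 set0I.
  apply: (@greedy_approx _ _ I) => //.
  - exact: indepb0.
  - exact: indepb_sub.
  - by move=> M Z; apply: laminar_exchange.
  - by apply: greedy_run.
  by apply: run_stop; rewrite seen_nil setD0 cardsT.
have := Ex_setI_ge fmono fsub T coin01.
have := le_Ex coin01 leH.
by rewrite ExB ExZ Ex_cst -!natr1; lra.
Qed.

Lemma Ex_uncrowded_ge T : indep_k F mu T ->
  9%:R / (1000 * k * (k + 1))%:R * f T
  <= Ex coin (fun H => f (candidates f H :&: uncrowded (candidates f H))).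
Proof.
move=> IT.
set sa := Ex coin (fun H => all_gain (hist H)).
have leN := le_Ex coin01 f_uncrowded_ge.
have le_pot : Ex coin (fun H => \sum_(j | essp j) overflow_pot j (hist H))
    <= (80 * k%:R)^-1 * sa.
  rewrite Ex_sum; apply: (@le_trans _ _ (\sum_(j | essp j) capw k R (mu j.1 j.2)
     * Ex coin (fun H => gain f (fun e _ => e \in j.2) (hist H)))).
    by apply: ler_sum => j _; apply: Ex_overflow_pot.
  under eq_bigr => j _ do rewrite -ExZ.
  rewrite -Ex_sum -ExZ; apply: le_Ex; first exact: coin01.
  by move=> H; apply: sum_ess_gain; apply: greedy_run.
have le_tail := Ex_tail_gain I fmono #|U| coin01.
have le_sa : Ex coin (fun H => f (heads (hist H))) - f set0 <= sa.
  rewrite -[f set0](Ex_cst U coin) -ExB; apply: le_Ex; first exact: coin01.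
  by move=> H; apply: f_heads_le.
have le_heads := Ex_heads_ge IT.
rewrite ExB ExD Ex_cst in leN.
have fT : f set0 <= f T by apply: fmono; apply: sub0set.
have f00 := f0 set0.
have k1 := kR; have := invk; have := coinE; set u : R := k%:R^-1 => cE u01.
set s : R := k.+1%:R^-1.
have s01 : 0 < s <= 1 by rewrite invr_gt0 ltr0n invf_le1 ?ltr0n ?ler1n.
have -> : 9%:R / (1000 * k * (k + 1))%:R = 9 / 1000 * (u * s) :> R.
  by rewrite /u /s !natrM addn1 -natr1; field; lra.
have c80 : (80 * k%:R)^-1 = u / 80 :> R by rewrite /u; field; lra.
rewrite c80 in le_pot.
(* The net rate: [p q] from the martingale bound minus the overflow loss [1 / (80 k)]. *)
pose a := (1 - coin) * coin - u / 80.
have aE : a = u * (1 / 80 - u / 1600) by rewrite /a cE; field.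
have a0 : 0 <= a by rewrite aE mulr_ge0; lra.
have le_hd : s * coin * (f T - f set0) <= sa.
  apply: le_trans le_sa; rewrite -mulrA /s mulrC ler_pdivrMr ?ltr0n //.
  by rewrite [_ * k.+1%:R]mulrC.
have := ler_wpM2l a0 le_hd.
(* After division by [u] the right side is smallest at [u = 1], that is [k = 1], where it equals
   [741 / 64000]. *)
have le_a : 9 / 1000 * u <= a * coin.
  have : u * (9 / 1000) <= u * ((1 / 80 - u / 1600) * (1 - u / 40)).
    by rewrite ler_wpM2l //; nra.
  by rewrite aE cE; lra.
have : 9 / 1000 * u * (s * (f T - f set0)) <= a * coin * (s * (f T - f set0)).
  by rewrite ler_wpM2r // mulr_ge0; lra.
have : u * s * f set0 <= f set0 by rewrite ler_piMl // mulr_ile1; lra.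
have : 0 <= u * s * f set0 by rewrite !mulr_ge0; lra.
move: leN le_pot le_tail; rewrite -/sa; set X := Ex _ _; set Y := Ex _ _; set W := Ex _ _.
have -> : (1 - coin) * coin = a + u / 80 by rewrite /a; lra.
lra.
Qed.

End Value.

(** * The online algorithm *)

(** List each set followed by its complement and match positions: [A] and [B] occupy the same
    initial segment. *)
Lemma exists_perm_imset (U : finType) (A B : {set U}) :
  #|A| = #|B| -> exists s : {perm U}, s @: A = B.
Proof.
move=> cAB; pose l (S : {set U}) := enum S ++ enum (~: S).
have size_l S : size (l S) = #|U| by rewrite size_cat -!cardE cardsC.
have uniq_l S : uniq (l S).
  rewrite cat_uniq !enum_uniq andbT /=; apply/hasPn => x.
  by rewrite !mem_enum inE.
have mem_l S x : x \in l S by rewrite mem_cat !mem_enum inE orbN.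
pose g x := nth x (l B) (index x (l A)).
have lt_idx x : (index x (l A) < size (l B))%N.
  by rewrite size_l -(size_l A) index_mem.
have g_inj : injective g.
  move=> x y; rewrite /g (set_nth_default y) // => /eqP.
  by rewrite nth_uniq // => /eqP; apply: (@index_inj _ x).
exists (perm g_inj); apply/eqP; rewrite eqEcard card_imset ?cAB ?leqnn ?andbT.
  apply/subsetP => _ /imsetP[x xA ->]; rewrite permE /g nth_cat.
  have lt_x : (index x (l A) < size (enum B))%N.
    by rewrite index_cat mem_enum xA -cardE -cAB cardE index_mem mem_enum.
  by rewrite lt_x -mem_enum mem_nth.
exact: perm_inj.
Qed.

(** Composing with a permutation that takes [A] to [B] is a bijection of the group, so the law of a
    random image depends only on the size. *)
Lemma sum_perm_imset (R : realFieldType) (U : finType) (A B : {set U})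
    (G : {set U} -> R) : #|A| = #|B| ->
  \sum_(s : {perm U}) G (s @: A) = \sum_(s : {perm U}) G (s @: B).
Proof.
move=> /exists_perm_imset[t <-].
rewrite (reindex_inj (mulgI t)) /=; apply: eq_bigr => s _; congr G.
by rewrite -imset_comp; apply: eq_imset => x; rewrite /= permM.
Qed.

Section Online.
Variables (R : realType) (U : finType) (k : nat) (F : 'I_k -> {set {set U}}).
Variable mu : 'I_k -> {set U} -> nat.
Implicit Types (f : {set U} -> R) (s : seq U) (A H : {set U}).

Local Notation I := (indepb F mu).

(** Greedy runs on [y |: H] alone, so the test queries [f] only on arrived elements. *)
Definition cand f H y : bool := y \in tails (run I f (y |: H) #|U| H [::]).

(** The random outcome [A] matters only through its size: the sample is the first [#|A|]
    arrivals. *)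
Definition seen_cand f A s : {set U} :=
  let H := [set x in take #|A| s] in [set y in s | (y \notin H) && cand f H y].

Definition decide A s f : bool :=
  if s is x0 :: _ then
    last x0 s \in seen_cand f A s :&: uncrowded F mu (seen_cand f A s)
  else false.

Lemma candE f H y : y \notin H -> cand f H y = (y \in candidates F mu f H).
Proof.
move=> yH; rewrite /cand /candidates.
rewrite (@run_restrict _ _ I f (y |: H) H #|U| #|U| [::] [::]).
- by rewrite in_setI setU11 andbT.
- exact: subsetUr.
- by rewrite heads_nil sub0set.
- by [].
- by rewrite tails_nil set0I.
- exact: max_card.
- exact: max_card.
Qed.

Lemma decide_local A s f f' :
  (forall S : {set U}, S \subset [set x in s] -> f S = f' S) ->
  decide A s f = decide A s f'.
Proof.
move=> eqf.
suff eqN : seen_cand f A s = seen_cand f' A s by rewrite /decide eqN.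
rewrite /seen_cand /=; set H := [set x in take _ _].
apply/setP => y; rewrite ![y \in [set _ in _ | _]]inE.
case: (boolP (y \in s)) => //= ys; congr (_ && _).
rewrite /cand (@eq_run _ _ _ f f') //; last by rewrite heads_nil sub0set.
move=> S sS; apply: eqf; apply: subset_trans sS _.
apply/subsetP => x; rewrite !inE => /orP[/eqP ->//|]; exact: mem_take.
Qed.

(** * A single run, for a fixed outcome and arrival order *)

Section Run.
Variables (A : {set U}) (sigma : {perm U}) (f : {set U} -> R).

Let s := arrival sigma.
Let sample : {set U} := [set x in take #|A| s].
Let N := candidates F mu f sample.
Let pre x := take (index x s).+1 s.

Let s_mem x : x \in s.
Proof.
by apply/mapP; exists ((sigma^-1)%g x); rewrite ?permKV // mem_enum.
Qed.

Let mem_pre x y : (y \in pre x) = (index y s <= index x s)%N.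
Proof. by rewrite in_take ?ltnS. Qed.

Let mem_sample x : (x \in sample) = (index x s < #|A|)%N.
Proof. by rewrite inE in_take. Qed.

Let N_sample x : x \in N -> x \notin sample.
Proof.
move=> xN; have dis : [disjoint N & sample].
  by apply: run_tails; rewrite tails_nil -setI_eq0 set0I.
by rewrite (disjointFr dis xN).
Qed.

Let last_pre x x0 : last x0 (pre x) = x.
Proof.
have lt_x : (index x s < size s)%N by rewrite index_mem.
by rewrite /pre (take_nth x) // last_rcons nth_index.
Qed.

Let seen_candE x : seen_cand f A (pre x) =
  if x \in sample then set0 else [set y in N | y \in pre x].
Proof.
rewrite /seen_cand mem_sample; case: ltnP => lt_x.
  rewrite take_oversize ?size_take; last by case: ifP; lia.
  by apply/setP => y; rewrite !inE; case: (y \in _).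
rewrite /pre take_takel; last by lia.
rewrite -/sample -/(pre x); apply/setP => y; rewrite [LHS]in_set [RHS]in_set.
case: (boolP (y \in pre x)) => yx /=; last by rewrite andbF.
rewrite andbT; case: (boolP (y \in sample)) => ys /=.
  by apply/esym/negP => /N_sample; rewrite ys.
by rewrite candE.
Qed.

Let decide_pre x : decide A (pre x) f =
  (x \in seen_cand f A (pre x) :&: uncrowded F mu (seen_cand f A (pre x))).
Proof.
have := last_pre x x; have : x \in pre x by rewrite mem_pre.
by rewrite /decide; case: (pre x) => // x0 l _ /= ->.
Qed.

(** Consider the last accepted element of [B] to arrive: all accepted elements of [B] are candidates
    seen by then, and its acceptance means that those candidates fit the capacity. *)
Lemma accepted_indep : indep_k F mu [set x | decide A (pre x) f].
Proof.
move=> i B BF; set S := [set x | _] :&: B.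
have [->|[x0 x0S]] := set_0Vmem S; first by rewrite cards0.
case: (@arg_maxnP _ x0 (mem S) (fun x => index x s) x0S) => x xS xmax.
have /setIP[] := xS; rewrite inE decide_pre => /setIP[xN].
rewrite [_ \in uncrowded _ _ _]inE => /forallP/(_ i)/forall_inP/(_ B BF)/implyP le_mu xB.
apply: leq_trans (le_mu xB); apply: subset_leq_card; rewrite subsetI subsetIr andbT.
apply/subsetP => y yS; have /setIP[] := yS; rewrite inE decide_pre => /setIP[yN _] _.
move: xN yN; rewrite !seen_candE; case: ifP => _; first by rewrite in_set0.
move=> _; case: ifP => _; first by rewrite in_set0.
rewrite ![y \in [set _ in N | _]]in_set => /andP[-> _] /=.
by rewrite mem_pre; apply: xmax.
Qed.

(** The candidates seen when [x] arrives form a subset of [N], so an element uncrowded in hindsight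
    is uncrowded on arrival too. *)
Lemma uncrowded_accepted :
  N :&: uncrowded F mu N \subset [set x | decide A (pre x) f].
Proof.
apply/subsetP => x /setIP[xN xU]; rewrite inE decide_pre seen_candE.
rewrite (negPf (N_sample xN)) in_setI [x \in [set _ in N | _]]in_set xN mem_pre leqnn /=.
move: xU; rewrite ![x \in uncrowded _ _ _]in_set => /forallP xU; apply/forallP => i.
apply/forall_inP => B BF; apply/implyP => xB.
have /forall_inP/(_ B BF)/implyP/(_ xB) := xU i; apply: leq_trans.
by apply: subset_leq_card; apply: setSI; apply/subsetP => y; rewrite in_set => /andP[].
Qed.

End Run.

End Online.

Unset Implicit Arguments.

Theorem theorem2 (R : realType) (k : nat) (hk : (1 <= k)%N) (U : finType)
  (F : 'I_k -> {set {set U}}) (mu : 'I_k -> {set U} -> nat)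
  (hlam : forall i, laminar (F i)) :
  exists (m : nat) (p : 'I_m -> R)
         (dec : 'I_m -> seq U -> ({set U} -> R) -> bool),
    [/\ prob_dist p,
        online_local dec
      & forall f : {set U} -> R, valid_fun f ->
          (forall (w : 'I_m) (sigma : {perm U}),
              indep_k F mu (alg_set dec w sigma f)) /\
          (forall T : {set U}, indep_k F mu T ->
              9%:R / (1000 * k * (k + 1))%:R * f T <= expected_value p dec f)].
Proof.
pose c := coin R k.
have c01 : 0 <= c <= 1 := coin01 R hk.
(* An outcome is a subset with its product weight, so its size has the binomial law required of the
   sample size. *)
exists #|{set U}|, (fun w => wt c (enum_val w)),
  (fun w s f => decide F mu (enum_val w) s f).
split.
- split=> [w|]; first exact: wt_ge0.
  by rewrite -(sum_wt U c) [RHS](big_enum_val (A := {set U})).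
- by move=> w s f f'; apply: decide_local.
move=> f vf; split=> [w sigma|T IT]; first exact: accepted_indep.
apply: le_trans (Ex_uncrowded_ge hlam hk vf IT) _; rewrite -/c.
set G := fun H : {set U} => f _.
pose first n : {set U} := [set x in take n (enum U)].
have sampleE (A : {set U}) (sigma : {perm U}) :
    [set x in take #|A| (arrival sigma)] = sigma @: first #|A|.
  apply/setP => x; rewrite inE -map_take; apply/mapP/imsetP => -[y yt ->]; exists y => //.
    by rewrite inE.
  by move: yt; rewrite inE.
have card_first (A : {set U}) : #|first #|A| | = #|A|.
  rewrite cardsE (card_uniqP _) ?take_uniq ?enum_uniq // size_takel //.
  by rewrite -cardE max_card.
have nz : #|{perm U}|%:R != 0 :> R.
  by rewrite pnatr_eq0 -lt0n; apply/card_gt0P; exists 1%g.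
(* In random order, a prefix of length [#|A|] has the law of the random image of [A]; invariance of
   the product measure then removes the permutation. *)
have -> : Ex c G = #|{perm U}|%:R^-1 *
    \sum_(sigma : {perm U}) \sum_(A : {set U}) wt c A * G (sigma @: first #|A|).
  rewrite exchange_big /=.
  under eq_bigr => A _ do rewrite -mulr_sumr (sum_perm_imset G (card_first A)) mulr_sumr.
  rewrite exchange_big /=.
  under eq_bigr => sigma _ do rewrite -/(Ex c (fun A => G (sigma @: A))) Ex_imset.
  by rewrite sumr_const -[X in _ * X]mulr_natl mulKf.
rewrite /expected_value ler_wpM2l ?invr_ge0 ?ler0n //; apply: ler_sum => sigma _.
rewrite (big_enum_val (A := {set U})) /=; apply: ler_sum => w _.
rewrite ler_wpM2l ?wt_ge0 // -sampleE; case: (vf) => _ fmono _; apply: fmono.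
exact: uncrowded_accepted.
Qed.
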